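(* Let $d\ge1$, $q\ge1$, let $\mathbf c_1,\dots,\mathbf c_q\in\mathbb R^d$, $w_1,\dots,w_q>0$, $c_s>0$ be a lattice satisfying the isotropy conditions stated in the context, and let $\mathbf h:\mathbb R^d\to\mathbb R^q$, $h_i(\mathbf u)=\sqrt{w_i}\big(1+\frac{\mathbf c_i\cdot\mathbf u}{2c_s^2}+\frac{(\mathbf c_i\cdot\mathbf u)^2}{8c_s^4}-\frac{\|\mathbf u\|^2}{4c_s^2}\big)$, and $\mathbf g(\rho,\mathbf u)=\sqrt\rho\,\mathbf h(\mathbf u)$ for $\rho\ge0$, $\mathbf u\in\mathbb R^d$. Let $\mathbf H=\nabla^2\mathbf h$ be the (constant) Hessian tensor, $H_{ikl}=\partial_k\partial_l h_i$, and $\|\mathbf H\|_2=\sup_{\|\mathbf a\|=\|\mathbf b\|=1}\big\|\big(\sum_{k,l}H_{ikl}a_kb_l\big)_{i=1}^q\big\|$. Fix a reference velocity $\hat{\mathbf u}\in\mathbb R^d$ such that $\bar J=[\mathbf h(\hat{\mathbf u}),\partial_1\mathbf h(\hat{\mathbf u}),\dots,\partial_d\mathbf h(\hat{\mathbf u})]\in\mathbb R^{q\times(d+1)}$ has full column rank, let $\hat V$ be its column space and $\mathcal D=\bar J(\bar J^\top\bar J)^{-1}\bar J^\top$ the orthogonal projector onto $\hat V$. Let $\tilde{\mathbf g}\in\mathbb R^q$ be arbitrary and $\hat\rho>0$ a reference density. Define $\mathcal E^\perp=\inf_{\rho\ge0,\,\mathbf u\in\mathbb R^d}\|\mathcal D\tilde{\mathbf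 g}-\mathbf g(\rho,\mathbf u)\|$, $\Delta=\|\sqrt{\hat\rho}\,\mathbf h(\hat{\mathbf u})-\tilde{\mathbf g}\|$, and $\beta=1/\sigma_{\min}(\nabla\mathbf g(\hat\rho,\hat{\mathbf u}))$, where $\nabla\mathbf g(\hat\rho,\hat{\mathbf u})=[\partial_\rho\mathbf g,\partial_{u_1}\mathbf g,\dots,\partial_{u_d}\mathbf g](\hat\rho,\hat{\mathbf u})\in\mathbb R^{q\times(d+1)}$ (which has full column rank) and $\sigma_{\min}$ is its smallest singular value. Let $\mathcal F(\rho,\mathbf u)=\mathcal D\,\mathbf g(\rho,\mathbf u)$ with Jacobian $D_{\mathcal F}$, let $\mathbf z_0=\nabla\mathbf g(\hat\rho,\hat{\mathbf u})^{+}\big(\mathcal F(\hat\rho,\hat{\mathbf u})-\mathcal D\tilde{\mathbf g}\big)$ (with $^{+}$ the Moore–Penrose pseudoinverse), $r=\|\mathbf z_0\|$, $(\rho_1,\mathbf u_1)=(\hat\rho,\hat{\mathbf u})-\mathbf z_0$, and $B$ the open ball in $\mathbb R^{1+d}$ of radius $r$ centered at $(\rho_1,\mathbf u_1)$. Assume (Newton–Kantorovich conditions) that $B\subset(0,\infty)\times\mathbb R^d$, that $D_{\mathcal F}$ is Lipschitz on $B$ with constant $\mu$ (in operator norm), and that $2\beta\mu r\le1$. Then $$\mathcal E^\perp\le 2\beta^2\Delta^2\|\mathbf H\|_2\sqrt{\hat\rho+2\beta\Delta}.$$ Furthermore, if $\mathbf h(\hat{\mathbf u})^\top\tilde{\mathbf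 g}>0$, then the choice $\sqrt{\hat\rho}=\mathbf h(\hat{\mathbf u})^\top\tilde{\mathbf g}/\|\mathbf h(\hat{\mathbf u})\|^2$ minimizes $\Delta$ over $\hat\rho>0$, and for this choice $\Delta=\|\tilde{\mathbf g}\|\,|\sin\theta|$, where $\cos\theta=\dfrac{\mathbf h(\hat{\mathbf u})^\top\tilde{\mathbf g}}{\|\mathbf h(\hat{\mathbf u})\|\,\|\tilde{\mathbf g}\|}$.
   Context: Isotropy conditions on the lattice: $\sum_i w_i=1$, $\sum_i w_i c_{ik}c_{il}=c_s^2\delta_{kl}$, $\sum_i w_i c_{ik}c_{il}c_{ip}c_{iq}=c_s^4(\delta_{kl}\delta_{pq}+\delta_{kp}\delta_{lq}+\delta_{kq}\delta_{lp})$, and all weighted velocity moments of orders 1, 3 and 5 vanish. Here $\mathbf g(\rho,\mathbf u)$ parametrizes the (second-order truncated) manifold of square-root equilibrium distributions, $\mathcal D$ is the ''denoising'' projector onto its tangent space at reference velocity $\hat{\mathbf u}$, and $\mathcal E^\perp$ is the distance from $\mathcal D\tilde{\mathbf g}$ to that manifold. *)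

(* Defs.v *)
From mathcomp Require Import all_boot all_algebra.
From mathcomp Require Import all_classical all_reals all_analysis.
Set Implicit Arguments. Unset Strict Implicit. Unset Printing Implicit Defensive.
Import GRing.Theory Num.Theory.
Local Open Scope ring_scope.
Local Open Scope classical_set_scope.

Section Defs.
Variable R : realType.

Definition dotv n (a b : 'cV[R]_n) : R := \sum_(i < n) a i 0 * b i 0.
Definition enorm n (a : 'cV[R]_n) : R := Num.sqrt (\sum_(i < n) a i 0 ^+ 2).

Definition ev n (k : 'I_n) : 'cV[R]_n := delta_mx k 0.

Definition jac m n (f : 'cV[R]_m -> 'cV[R]_n) (x : 'cV[R]_m) : 'M[R]_(n, m) :=
  \matrix_(i, j) (derive f x (ev j)) i 0.

Definition opnorm m n (A : 'M[R]_(m, n)) : R :=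
  sup [set enorm (A *m x) | x in [set x : 'cV[R]_n | enorm x = 1]].

Definition sigma_min m n (A : 'M[R]_(m, n)) : R :=
  Num.sqrt (inf [set l : R | eigenvalue (A^T *m A) l]).

Definition is_pinv m n (A : 'M[R]_(m, n)) (X : 'M[R]_(n, m)) : Prop :=
  [/\ A *m X *m A = A, X *m A *m X = X,
      (A *m X)^T = A *m X & (X *m A)^T = X *m A].

Definition kd n (k l : 'I_n) : R := (k == l)%:R.

Definition isotropic q d (c : 'M[R]_(q, d)) (w : 'I_q -> R) (cs : R) : Prop :=
  \sum_(i < q) w i = 1 /\
  [/\ forall k : 'I_d, \sum_(i < q) w i * c i k = 0,
      forall k l : 'I_d, \sum_(i < q) w i * c i k * c i l = cs ^+ 2 * kd k l,
      forall k l p : 'I_d, \sum_(i < q) w i * c i k * c i l * c i p = 0,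
      forall k l p s : 'I_d, \sum_(i < q) w i * c i k * c i l * c i p * c i s
          = cs ^+ 4 * (kd k l * kd p s + kd k p * kd l s + kd k s * kd l p)
    & forall k1 k2 k3 k4 k5 : 'I_d,
        \sum_(i < q) w i * c i k1 * c i k2 * c i k3 * c i k4 * c i k5 = 0].

Definition hfun q d (c : 'M[R]_(q, d)) (w : 'I_q -> R) (cs : R) (u : 'cV[R]_d)
  : 'cV[R]_q :=
  \col_i (Num.sqrt (w i) *
     (1 + (\sum_k c i k * u k 0) / (2 * cs ^+ 2)
        + (\sum_k c i k * u k 0) ^+ 2 / (8 * cs ^+ 4)
        - (\sum_k u k 0 ^+ 2) / (4 * cs ^+ 2))).

Definition gfun q d c w cs (rho : R) (u : 'cV[R]_d) : 'cV[R]_q :=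
  Num.sqrt rho *: @hfun q d c w cs u.

Definition pairv d (rho : R) (u : 'cV[R]_d) : 'cV[R]_(1 + d) := col_mx rho%:M u.
Definition rho_of d (z : 'cV[R]_(1 + d)) : R := (usubmx z : 'M[R]_1) 0 0.
Definition u_of d (z : 'cV[R]_(1 + d)) : 'cV[R]_d := dsubmx z.
Definition gz q d c w cs (z : 'cV[R]_(1 + d)) : 'cV[R]_q :=
  @gfun q d c w cs (rho_of z) (u_of z).

Definition hess q d c w cs (u : 'cV[R]_d) (k l : 'I_d) : 'cV[R]_q :=
  derive (fun v => derive (@hfun q d c w cs) v (ev l)) u (ev k).

(* ||H||_2 (H is constant; evaluated at the point u) *)
Definition Hnorm q d c w cs (u : 'cV[R]_d) : R :=
  sup [set x | exists a b : 'cV[R]_d, [/\ enorm a = 1, enorm b = 1 &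
        x = enorm (\sum_(k < d) \sum_(l < d) (a k 0 * b l 0) *: @hess q d c w cs u k l)]].

Definition Jbar q d c w cs (uh : 'cV[R]_d) : 'M[R]_(q, 1 + d) :=
  row_mx (@hfun q d c w cs uh) (jac (@hfun q d c w cs) uh).

Definition Dproj q d c w cs (uh : 'cV[R]_d) : 'M[R]_q :=
  let J := @Jbar q d c w cs uh in J *m invmx (J^T *m J) *m J^T.

Definition Eperp q d c w cs (uh : 'cV[R]_d) (gt : 'cV[R]_q) : R :=
  inf [set x | exists rho (u : 'cV[R]_d), 0 <= rho /\
        x = enorm (@Dproj q d c w cs uh *m gt - @gfun q d c w cs rho u)].

Definition Delta q d c w cs (uh : 'cV[R]_d) (gt : 'cV[R]_q) (rh : R) : R :=
  enorm (Num.sqrt rh *: @hfun q d c w cs uh - gt).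

Definition gradg q d c w cs (rh : R) (uh : 'cV[R]_d) : 'M[R]_(q, 1 + d) :=
  jac (@gz q d c w cs) (pairv rh uh).

Definition Ffun q d c w cs (uh : 'cV[R]_d) (z : 'cV[R]_(1 + d)) : 'cV[R]_q :=
  @Dproj q d c w cs uh *m @gz q d c w cs z.
Definition DF q d c w cs (uh : 'cV[R]_d) (z : 'cV[R]_(1 + d)) : 'M[R]_(q, 1 + d) :=
  jac (@Ffun q d c w cs uh) z.

End Defs.

(* Main.v *)
(** Put [x0 = (rh, uh)], [A] for the pseudoinverse of the Jacobian at [x0], and
    [T x = x - A (g x - gt)], so that [x1 = T x0] is the first Newton step and
    zeros of [F - D gt] are fixed points of [T].  Since [A] maps into the
    parameter space with norm at most [beta], the Lipschitz condition gives
    [|T'(x)| <= beta mu |x - x0|] on the ball [B], hence with [2 beta mu r <= 1]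
    both [|T'| <= 1] on [B] and, integrating from [x0], [|T x - x1| <= r].
    A nonexpansive map of a ball into its closure has approximate fixed points,
    which suffices because [Eperp] is an infimum: no exact solution of
    [F = D gt] is needed.  At an approximate fixed point [x], [D] cancels the
    constant and linear parts of the quadratic map [h] around [uh], so
    [D g x - g x] is controlled by the Hessian and [|x - x0| <= 2 r <= 2 beta Delta]. *)
Require Import Defs.
From mathcomp Require Import all_boot all_order all_algebra.
From mathcomp Require Import all_classical all_reals all_analysis.
From mathcomp Require Import ring lra.
Import Order.TTheory GRing.Theory Num.Theory.
Import numFieldNormedType.Exports.
Local Open Scope ring_scope.
Local Open Scope classical_set_scope.
Set Implicit Arguments. Unset Strict Implicit. Unset Printing Implicit Defensive.

(** * Euclidean geometry of column vectors *)

Section Euclid.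
Context {R : realType}.
Implicit Types n m : nat.

Lemma dotvE n (a b : 'cV[R]_n) : dotv a b = (a^T *m b) 0 0.
Proof. by rewrite mxE; apply: eq_bigr => i _; rewrite mxE. Qed.

Lemma dotvC n (a b : 'cV[R]_n) : dotv a b = dotv b a.
Proof. by apply: eq_bigr => i _; rewrite mulrC. Qed.

Lemma dotvDl n (a b x : 'cV[R]_n) : dotv (a + b) x = dotv a x + dotv b x.
Proof. by rewrite !dotvE linearD mulmxDl mxE. Qed.

Lemma dotvDr n (a b x : 'cV[R]_n) : dotv x (a + b) = dotv x a + dotv x b.
Proof. by rewrite !(dotvC x) dotvDl. Qed.

Lemma dotvZl n k (a b : 'cV[R]_n) : dotv (k *: a) b = k * dotv a b.
Proof. by rewrite !dotvE linearZ -scalemxAl mxE. Qed.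

Lemma dotvZr n k (a b : 'cV[R]_n) : dotv a (k *: b) = k * dotv a b.
Proof. by rewrite !(dotvC a) dotvZl. Qed.

Lemma dotvNl n (a b : 'cV[R]_n) : dotv (- a) b = - dotv a b.
Proof. by rewrite -scaleN1r dotvZl mulN1r. Qed.

Lemma dotvNr n (a b : 'cV[R]_n) : dotv a (- b) = - dotv a b.
Proof. by rewrite -scaleN1r dotvZr mulN1r. Qed.

Lemma dotv0l n (b : 'cV[R]_n) : dotv 0 b = 0.
Proof. by rewrite dotvE trmx0 mul0mx mxE. Qed.

Lemma dotv_mulmxl m n (A : 'M[R]_(m, n)) a b :
  dotv (A *m a) b = dotv a (A^T *m b).
Proof. by rewrite !dotvE trmx_mul mulmxA. Qed.

Lemma dotv_ge0 n (a : 'cV[R]_n) : 0 <= dotv a a.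
Proof. by apply: sumr_ge0 => i _; rewrite -expr2 sqr_ge0. Qed.

Lemma enormE n (a : 'cV[R]_n) : enorm a = Num.sqrt (dotv a a).
Proof. by congr Num.sqrt; apply: eq_bigr => i _; rewrite expr2. Qed.

Lemma enorm_ge0 n (a : 'cV[R]_n) : 0 <= enorm a.
Proof. exact: sqrtr_ge0. Qed.
#[local] Hint Extern 0 (is_true (0 <= enorm _)) =>
  solve [apply: enorm_ge0] : core.

Lemma sqr_enorm n (a : 'cV[R]_n) : enorm a ^+ 2 = dotv a a.
Proof. by rewrite enormE sqr_sqrtr ?dotv_ge0. Qed.

Lemma enormZ n k (a : 'cV[R]_n) : enorm (k *: a) = `|k| * enorm a.
Proof.
by rewrite !enormE dotvZl dotvZr mulrA -expr2 sqrtrM ?sqr_ge0// sqrtr_sqr.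
Qed.

Lemma enormN n (a : 'cV[R]_n) : enorm (- a) = enorm a.
Proof. by rewrite -scaleN1r enormZ normrN1 mul1r. Qed.

Lemma enormBC n (a b : 'cV[R]_n) : enorm (a - b) = enorm (b - a).
Proof. by rewrite -enormN opprB. Qed.

Lemma enorm0 n : enorm (0 : 'cV[R]_n) = 0.
Proof. by rewrite -[0](scale0r 0) enormZ normr0 mul0r. Qed.

Lemma enorm_coord n (a : 'cV[R]_n) i : `|a i 0| <= enorm a.
Proof.
rewrite -ler_sqr ?nnegrE// sqr_enorm real_normK ?num_real// expr2.
rewrite /dotv (bigD1 i)//= lerDl sumr_ge0// => j _.
by rewrite -expr2 sqr_ge0.
Qed.

Lemma enorm_eq0 n (a : 'cV[R]_n) : (enorm a == 0) = (a == 0).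
Proof.
apply/eqP/eqP => [a0|->]; last exact: enorm0.
apply/colP => i; rewrite mxE; apply/eqP.
by rewrite -normr_le0 -a0 enorm_coord.
Qed.

Lemma enorm_gt0 n (a : 'cV[R]_n) : (0 < enorm a) = (a != 0).
Proof. by rewrite lt0r enorm_eq0 enorm_ge0 andbT. Qed.

Lemma cauchy_schwarz n (a b : 'cV[R]_n) : dotv a b <= enorm a * enorm b.
Proof.
have [->|b0] := eqVneq b 0.
  by rewrite enorm0 mulr0 dotvC dotv0l.
have [->|a0] := eqVneq a 0.
  by rewrite enorm0 mul0r dotv0l.
rewrite -enorm_gt0 in a0; rewrite -enorm_gt0 in b0.
have := dotv_ge0 (enorm b *: a - enorm a *: b).
rewrite dotvDl !dotvDr !dotvNl !dotvNr !dotvZl !dotvZr -!sqr_enorm (dotvC b a).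
move=> h; have : 0 <= (enorm a * enorm b) * (enorm a * enorm b - dotv a b) by lra.
by rewrite pmulr_rge0 ?mulr_gt0// subr_ge0.
Qed.

Lemma ler_enormD n (a b : 'cV[R]_n) : enorm (a + b) <= enorm a + enorm b.
Proof.
rewrite -ler_sqr ?nnegrE ?addr_ge0// sqr_enorm dotvDl !dotvDr (dotvC b a).
rewrite -!sqr_enorm; have := cauchy_schwarz a b; lra.
Qed.

Lemma ler_enorm_sum n (I : Type) (s : seq I) (F : I -> 'cV[R]_n) :
  enorm (\sum_(i <- s) F i) <= \sum_(i <- s) enorm (F i).
Proof.
elim/big_ind2: _ => [|x1 x2 y1 y2 h1 h2|//]; first by rewrite enorm0.
exact: le_trans (ler_enormD _ _) (lerD h1 h2).
Qed.

(** Testing with [l = a] suffices; the dual form reduces vector bounds to scalar ones, to which the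
    mean value theorem and limits apply. *)
Lemma le_enorm_dual n (a : 'cV[R]_n) k : 0 <= k ->
  (forall l, dotv l a <= enorm l * k) -> enorm a <= k.
Proof.
move=> k0 /(_ a); rewrite -sqr_enorm expr2.
have [->//|a0] := eqVneq (enorm a) 0.
by rewrite ler_pM2l// lt0r a0 enorm_ge0.
Qed.

Lemma mulmx_bounded m n (A : 'M[R]_(m, n)) :
  exists2 K, 0 < K & forall x, enorm (A *m x) <= K * enorm x.
Proof.
exists (1 + \sum_j enorm (col j A)).
  by rewrite ltr_pwDl// sumr_ge0.
move=> x; rewrite -[A *m x]trmxK trmx_mul mulmx_sum_row linear_sum/=.
apply: le_trans (ler_enorm_sum _ _) _.
rewrite mulrDl mul1r mulr_suml ler_wpDl// ler_sum// => j _.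
rewrite linearZ /= enormZ -tr_col trmxK mulrC ler_wpM2l// mxE.
exact: enorm_coord.
Qed.

Lemma le_opnorm m n (A : 'M[R]_(m, n)) x : enorm (A *m x) <= opnorm A * enorm x.
Proof.
have [->|x0] := eqVneq x 0; first by rewrite mulmx0 !enorm0 mulr0.
have x0' : 0 < enorm x by rewrite enorm_gt0.
rewrite -ler_pdivrMr//; have [K K0 hK] := mulmx_bounded A.
(* A [sup] dominates its elements only once the set is known to be bounded, which the crude constant
   [K] provides. *)
apply: ub_le_sup.
  exists K => _ [y /= y1 <-]; by rewrite -[K]mulr1 -y1.
exists ((enorm x)^-1 *: x) => /=.
  by rewrite enormZ ger0_norm ?invr_ge0// mulVf// gt_eqF.
by rewrite -scalemxAr enormZ ger0_norm ?invr_ge0// mulrC.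
Qed.

End Euclid.

#[local] Hint Extern 0 (is_true (0 <= enorm _)) =>
  solve [apply: enorm_ge0] : core.

(** * The smallest singular value as a lower bound for a matrix *)

Section Spectral.
Context {R : realType}.

(** With [y = N x], invertibility gives [|x| <= C |y|], and positivity at a shifted point gives
    [K^-1 |y|^2 <= dotv y x]; chaining the two yields the constant. *)
Lemma psd_unitmx_coercive n (N : 'M[R]_n) : N^T = N ->
  (forall x, 0 <= dotv (N *m x) x) -> N \in unitmx ->
  exists2 k, 0 < k & forall x, k * enorm x ^+ 2 <= dotv (N *m x) x.
Proof.
move=> Nsym Npos Nu.
have [K K0 NK] := mulmx_bounded N; have [C C0 NC] := mulmx_bounded (invmx N).
exists (K * C ^+ 2)^-1; first by rewrite invr_gt0 mulr_gt0// exprn_gt0.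
move=> x; set y := N *m x.
have xy : enorm x <= C * enorm y by rewrite -{1}(mulKmx Nu x) NC.
(* positivity of the form at [x - K^-1 N x] *)
have := Npos (x - K^-1 *: y).
rewrite mulmxBr -scalemxAr dotvDl !dotvDr !dotvNl !dotvNr !dotvZl !dotvZr -/y.
rewrite [dotv (N *m y) x]dotv_mulmxl Nsym -/y -sqr_enorm.
have : dotv (N *m y) y <= K * enorm y ^+ 2.
  apply: le_trans (cauchy_schwarz _ _) _.
  by rewrite expr2 mulrA ler_wpM2r ?NK.
move=> h1 h2.
have {h1} h3 : K^-1 * (K^-1 * dotv (N *m y) y) <= K^-1 * enorm y ^+ 2.
  by apply: ler_wpM2l; [rewrite invr_ge0 ltW|rewrite ler_pdivrMl].
have h4 : K^-1 * enorm y ^+ 2 <= dotv y x by lra.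
apply: le_trans h4; rewrite invfM -mulrA.
apply: ler_wpM2l; first by rewrite invr_ge0 ltW.
by rewrite ler_pdivrMl ?exprn_gt0// -exprMn lerXn2r ?nnegrE// mulr_ge0// ltW.
Qed.

Lemma enorm_normalize n (x : 'cV[R]_n) : x != 0 ->
  enorm ((enorm x)^-1 *: x) = 1.
Proof.
by move=> x0; rewrite enormZ ger0_norm ?invr_ge0// mulVf// enorm_eq0.
Qed.

Lemma dotv_gram m n (A : 'M[R]_(m, n)) x :
  dotv (A^T *m A *m x) x = enorm (A *m x) ^+ 2.
Proof. by rewrite -mulmxA dotv_mulmxl trmxK sqr_enorm. Qed.

Lemma gram_sym m n (A : 'M[R]_(m, n)) : (A^T *m A)^T = A^T *m A.
Proof. by rewrite trmx_mul trmxK. Qed.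

Lemma eigenvalue_gram m n (A : 'M[R]_(m, n)) l : eigenvalue (A^T *m A) l ->
  exists2 x, x != 0 & enorm (A *m x) ^+ 2 = l * enorm x ^+ 2.
Proof.
case/eigenvalueP => v vl v0; exists v^T; first by rewrite trmx_eq0.
rewrite -dotv_gram -{1}(gram_sym A) -trmx_mul vl linearZ/= dotvZl.
by rewrite sqr_enorm.
Qed.

(** The infimum of the Rayleigh quotient is itself an eigenvalue: otherwise [A^T A - inf Q] would be
    invertible and positive semidefinite, hence coercive, and the infimum could be raised by [k]. No
    compactness of the sphere is involved. *)
Lemma eigenvalue_gram_min m n (A : 'M[R]_(m, n)) : (0 < n)%N ->
  exists2 l, eigenvalue (A^T *m A) l &
    forall x, l * enorm x ^+ 2 <= enorm (A *m x) ^+ 2.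
Proof.
move=> n0.
pose Q := [set enorm (A *m x) ^+ 2 | x in [set x : 'cV[R]_n | enorm x = 1]].
have Q0 : Q !=set0.
  pose e : 'cV[R]_n := const_mx 1.
  have e0 : e != 0.
    apply/eqP => /colP /(_ (Ordinal n0)); rewrite !mxE => /eqP.
    by rewrite oner_eq0.
  by eexists; exists ((enorm e)^-1 *: e) => //=; rewrite enorm_normalize.
have Qlb : has_lbound Q by exists 0 => _ [x _ <-]; exact: sqr_ge0.
have infQ x : inf Q * enorm x ^+ 2 <= enorm (A *m x) ^+ 2.
  have [->|x0] := eqVneq x 0; first by rewrite mulmx0 !enorm0 expr0n mulr0.
  have x0' : 0 < enorm x by rewrite enorm_gt0.
  rewrite -ler_pdivlMr ?exprn_gt0//; apply: ge_inf => //.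
  exists ((enorm x)^-1 *: x); first by rewrite /= enorm_normalize.
  rewrite -scalemxAr enormZ ger0_norm ?invr_ge0// exprMn exprVn mulrC//.
exists (inf Q) => //; apply: contraT => /negbTE Ne.
pose N := A^T *m A - (inf Q)%:M.
have Nx x : dotv (N *m x) x = enorm (A *m x) ^+ 2 - inf Q * enorm x ^+ 2.
  by rewrite mulmxBl mul_scalar_mx dotvDl dotvNl dotvZl dotv_gram -(sqr_enorm x).
have Nu : N \in unitmx.
  rewrite -row_free_unit -kermx_eq0; move: Ne.
  by rewrite /eigenvalue /eigenspace => /negbFE.
have Nsym : N^T = N by rewrite linearB/= gram_sym tr_scalar_mx.
have Npos x : 0 <= dotv (N *m x) x by rewrite Nx subr_ge0 infQ.
have [k k0 hk] := psd_unitmx_coercive Nsym Npos Nu.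
suff : inf Q + k <= inf Q by rewrite gerDl leNgt k0.
apply: lb_le_inf => // _ [x /= x1 <-].
by have := hk x; rewrite Nx x1 expr1n !mulr1 lerBrDl.
Qed.

(** The left inverse, bounded by [K], keeps every eigenvalue of the Gram matrix above [K ^- 2], so
    the infimum in [sigma_min] is positive; it lies below the eigenvalue that minimizes the Rayleigh
    quotient. *)
Lemma sigma_minP m n (A : 'M[R]_(m, n)) (X : 'M[R]_(n, m)) : (0 < n)%N ->
  X *m A = 1%:M ->
  0 < sigma_min A /\ forall x, sigma_min A * enorm x <= enorm (A *m x).
Proof.
move=> n0 XA; have [K K0 hK] := mulmx_bounded X.
have [l el ll] := eigenvalue_gram_min A n0.
set E := [set l | eigenvalue (A^T *m A) l].
have Elb : lbound E (K ^- 2).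
  move=> t /= /eigenvalue_gram[x x0 hx].
  have x0' : 0 < enorm x ^+ 2 by rewrite exprn_gt0// enorm_gt0.
  rewrite -(ler_pM2r x0') -hx ler_pdivrMl ?exprn_gt0// -exprMn.
  rewrite lerXn2r ?nnegrE ?mulr_ge0 ?(ltW K0)//.
  by rewrite -{1}(mul1mx x) -XA -mulmxA hK.
have E0 : 0 < inf E.
  apply: (@lt_le_trans _ _ (K ^- 2)); first by rewrite invr_gt0 exprn_gt0.
  by apply: lb_le_inf => //; exists l.
split=> [|x]; first by rewrite sqrtr_gt0.
rewrite -ler_sqr ?nnegrE ?mulr_ge0 ?sqrtr_ge0// exprMn sqr_sqrtr ?(ltW E0)//.
apply: le_trans (ll x); rewrite ler_wpM2r ?exprn_ge0//.
by apply: ge_inf => //; exists (K ^- 2).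
Qed.

End Spectral.

(** * Directional derivatives along lines and a mean value inequality *)

Section Calculus.
Context {R : realType}.

Lemma is_derive_line (V W : normedModType R) (f : V -> W) y v s l :
  is_derive (y + s *: v) v f l <-> is_derive s 1 (fun t => f (y + t *: v)) l.
Proof.
have E : (fun h => h^-1 *: ((f \o shift (y + s *: v)) (h *: v) - f (y + s *: v)))
       = (fun h => h^-1 *: (((fun t => f (y + t *: v)) \o shift s) (h *: (1 : R)) -
                           f (y + s *: v))).
  apply/funext => h /=; congr (_ *: (f _ - _)).
  rewrite (_ : h *: (1 : R) = h); last exact: mulr1.
  by rewrite scalerDl addrCA.
split=> -[]; rewrite /derivable /derive.
  by rewrite E => *; split.
by rewrite -E => *; split.
Qed.

Lemma is_derive_col (V : normedModType R) n (f : V -> 'cV[R]_n) x v (l : 'cV[R]_n) :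
  (forall i, is_derive x v (fun z => f z i 0) (l i 0)) -> is_derive x v f l.
Proof.
move=> h; have df : derivable f x v.
  by apply/derivable_mxP => i j; rewrite ord1; exact: ex_derive.
split=> //; rewrite derive_mx//; apply/matrixP => i j.
by rewrite ord1 mxE derive_val.
Qed.

Lemma is_derive_quad (a b e : R) :
  is_derive (0 : R) (1 : R) (fun t : R => a + t * b + t ^+ 2 * e) b.
Proof.
have -> : (fun t => a + t * b + t ^+ 2 * e) = horner (a%:P + 'X * b%:P + 'X^2 * e%:P).
  by apply/funext => t; rewrite !hornerE.
apply: is_derive_eq.
rewrite !poly.derivE. by rewrite !hornerE /= !addr0.
Qed.

(** Derivatives of the polynomial maps below are read off as the linear coefficient of an exact
    expansion along a line. *)
Lemma is_derive_quad_line (V : normedModType R) (f : V -> R) x v (b e : R) :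
  (forall t, f (x + t *: v) = f x + t * b + t ^+ 2 * e) -> is_derive x v f b.
Proof.
move=> hf; rewrite -[x]addr0 -(scale0r v); apply/is_derive_line.
by rewrite (funext hf); exact: is_derive_quad.
Qed.

(* the case [b = 0] bounds [p 1 - p 0] by a Lipschitz constant, the case [a = 0]
   by the first-order remainder with its factor 1/2 *)
Lemma enorm_mvt n (p dp : R -> 'cV[R]_n) (a b : R) : 0 <= a + b / 2 ->
  (forall (s : R) i, 0 <= s <= 1 -> is_derive s (1 : R) (fun t => p t i 0) (dp s i 0)) ->
  (forall s, 0 < s < 1 -> enorm (dp s) <= a + b * s) ->
  enorm (p 1 - p 0) <= a + b / 2.
Proof.
move=> ab0 hp hdp; apply: le_enorm_dual => // l.
(* [P] is the antiderivative of [enorm l * (a + b * s)], so by Cauchy-Schwarz [f] has nonpositive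
   derivative inside the interval. *)
pose P : {poly R} := (a%:P * 'X + (b / 2)%:P * 'X^2) * (enorm l)%:P.
pose f : R -> R := \sum_i (l i 0 \*: (fun t => p t i 0)) - horner P.
pose df s := dotv l (dp s) - enorm l * (a + b * s).
have fE (s : R) : f s = dotv l (p s) - enorm l * (a * s + b / 2 * s ^+ 2).
  rewrite /f /= [(_ - _) s]/(_ s - _ s) fct_sumE; congr (_ - _).
  by rewrite /P !hornerE /=; ring.
have hf (s : R) : 0 <= s <= 1 -> is_derive s (1 : R) f (df s).
  move=> s01; have := fun i => hp s i s01 => {}hp.
  apply: is_derive_eq; congr (_ - _).
  by rewrite /P !poly.derivE !hornerE /=; field.
have f01 (s : R) : s \in `]0, 1[%R -> is_derive s (1 : R) f (df s).
  by rewrite in_itv/= => /andP[s0 s1]; apply: hf; rewrite (ltW s0) (ltW s1).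
have fcont : {within `[0 : R, 1 : R], continuous f}.
  apply: derivable_within_continuous => s; rewrite in_itv/= => /hf fs.
  exact: ex_derive.
have [s] := MVT ltr01 f01 fcont.
rewrite in_itv/= => s01; rewrite subr0 mulr1 !fE => E.
have : df s <= 0.
  rewrite subr_le0; apply: le_trans (cauchy_schwarz _ _) _.
  by rewrite ler_wpM2l// hdp.
rewrite -E dotvDr dotvNr expr1n expr0n/=; lra.
Qed.

End Calculus.

(** * Exact expansions of [h], its Hessian, and the Jacobian of [g] *)

Section Lattice.
Context {R : realType} {q d : nat} (c : 'M[R]_(q, d)) (w : 'I_q -> R) (cs : R).
Context (cs0 : 0 < cs).
Notation h := (hfun c w cs).

Definition hjac (u : 'cV[R]_d) : 'M[R]_(q, d) := \matrix_(i, j) (Num.sqrt (w i) *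
  (c i j / (2 * cs ^+ 2) + (\sum_k c i k * u k 0) * c i j / (4 * cs ^+ 4)
   - u j 0 / (2 * cs ^+ 2))).

(** Half the Hessian form at [(b, b)]; independent of the base point because [h] is quadratic. *)
Definition hquad (b : 'cV[R]_d) : 'cV[R]_q := \col_i (Num.sqrt (w i) *
  ((\sum_k c i k * b k 0) ^+ 2 / (8 * cs ^+ 4)
   - (\sum_k b k 0 ^+ 2) / (4 * cs ^+ 2))).

Lemma hjac_mulE u b i : (hjac u *m b) i 0 = Num.sqrt (w i) *
  ((\sum_k c i k * b k 0) / (2 * cs ^+ 2)
   + (\sum_k c i k * u k 0) * (\sum_k c i k * b k 0) / (4 * cs ^+ 4)
   - dotv u b / (2 * cs ^+ 2)).
Proof.
rewrite mxE; set s := \sum_k c i k * u k 0.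
transitivity (\sum_j Num.sqrt (w i) * ((c i j * b j 0) / (2 * cs ^+ 2)
   + s * (c i j * b j 0) / (4 * cs ^+ 4) - (u j 0 * b j 0) / (2 * cs ^+ 2))).
  by apply: eq_bigr => j _; rewrite mxE -/s; ring.
rewrite -mulr_sumr sumrB big_split/= -!mulr_suml -mulr_sumr //.
Qed.

Lemma hfun_line u b t :
  h (u + t *: b) = h u + t *: (hjac u *m b) + t ^+ 2 *: hquad b.
Proof.
apply/colP => i.
transitivity (h u i 0 + t * (hjac u *m b) i 0 + t ^+ 2 * hquad b i 0);
  last by rewrite !mxE.
rewrite hjac_mulE ![hfun _ _ _ _ _ _]mxE [hquad _ _ _]mxE.
have -> : \sum_k c i k * (u + t *: b) k 0
        = (\sum_k c i k * u k 0) + t * (\sum_k c i k * b k 0).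
  rewrite mulr_sumr -big_split/=; apply: eq_bigr => k _.
  by rewrite !mxE mulrDr mulrCA.
have -> : \sum_k (u + t *: b) k 0 ^+ 2
   = (\sum_k u k 0 ^+ 2) + 2 * t * dotv u b + t ^+ 2 * (\sum_k b k 0 ^+ 2).
  rewrite !mulr_sumr -!big_split/=; apply: eq_bigr => k _.
  by rewrite !mxE; ring.
by field; rewrite gt_eqF.
Qed.

Lemma is_derive_hfun u b : is_derive u b h (hjac u *m b).
Proof.
apply: is_derive_col => i; apply: (is_derive_quad_line (e := hquad b i 0)) => t.
by rewrite hfun_line !mxE.
Qed.

Lemma jac_hfun u : jac h u = hjac u.
Proof.
apply/matrixP => i j; rewrite mxE (@derive_val _ _ _ _ _ _ _ (is_derive_hfun _ _)).
by rewrite /ev -colE mxE.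
Qed.

(** The first derivative [hjac] is affine in its base point, so the expansion along a line has zero
    quadratic term. *)
Lemma hessE u k l i : hess c w cs u k l i 0 =
  Num.sqrt (w i) * (c i k * c i l / (4 * cs ^+ 4) - kd R k l / (2 * cs ^+ 2)).
Proof.
set e := RHS; pose H : 'cV[R]_q := \col_i (Num.sqrt (w i) *
  (c i k * c i l / (4 * cs ^+ 4) - kd R k l / (2 * cs ^+ 2))).
have -> : e = H i 0 by rewrite mxE.
rewrite /hess; congr (fun_of_matrix _ i 0).
have -> : (fun v => derive h v (ev R l)) = (fun v => col l (hjac v)).
  apply/funext => v.
  by rewrite (@derive_val _ _ _ _ _ _ _ (is_derive_hfun _ _)) colE.
apply: derive_val; apply: is_derive_col => {}i {e}.
apply: (is_derive_quad_line (e := 0)) => t; rewrite !mxE mulr0 addr0.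
have -> : \sum_k0 c i k0 * (u + t *: ev R k) k0 0
        = (\sum_k0 c i k0 * u k0 0) + t * c i k.
  rewrite [X in _ = _ + t * X](_ : _ = \sum_k0 c i k0 * (ev R k) k0 0).
    rewrite mulr_sumr -big_split/=; apply: eq_bigr => k0 _.
    by rewrite !mxE mulrDr mulrCA.
  rewrite (bigD1 k)//= mxE !eqxx mulr1 big1 ?addr0// => j jk.
  by rewrite mxE (negbTE jk) mulr0.
rewrite andbT /kd (eq_sym l k).
by field; rewrite gt_eqF.
Qed.

Lemma hquadE u b :
  hquad b = 2^-1 *: \sum_k \sum_l (b k 0 * b l 0) *: hess c w cs u k l.
Proof.
apply/colP => i; rewrite !mxE summxE.
transitivity (2^-1 * \sum_k \sum_l Num.sqrt (w i) *
  ((c i k * b k 0) * (c i l * b l 0) / (4 * cs ^+ 4) -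
   b k 0 * b l 0 * kd R k l / (2 * cs ^+ 2))); last first.
  congr (_ * _); apply: eq_bigr => k _; rewrite summxE; apply: eq_bigr => l _.
  by rewrite mxE hessE; ring.
set S := \sum_k c i k * b k 0.
transitivity (2^-1 * \sum_k Num.sqrt (w i) * (c i k * b k 0 * (S / (4 * cs ^+ 4)) -
    (\sum_l b k 0 * b l 0 * kd R k l) / (2 * cs ^+ 2))); last first.
  congr (_ * _); apply: eq_bigr => k _.
  by rewrite -mulr_sumr sumrB -!mulr_suml -mulr_sumr -/S !mulrA.
rewrite -mulr_sumr sumrB -!mulr_suml -/S.
have -> : \sum_k \sum_l b k 0 * b l 0 * kd R k l = \sum_k b k 0 ^+ 2.
  apply: eq_bigr => k _; rewrite (bigD1 k)//= /kd eqxx mulr1 -expr2.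
  rewrite big1 ?addr0// => l lk.
  by rewrite eq_sym (negbTE lk) mulr0.
by field; rewrite gt_eqF.
Qed.

(** By homogeneity of degree two, the normalized [b], used in both slots, is a competitor in the
    supremum defining [Hnorm]. *)
Lemma hquad_le u b : enorm (hquad b) <= 2^-1 * (Hnorm c w cs u * enorm b ^+ 2).
Proof.
have [->|b0] := eqVneq b 0.
  rewrite [hquad 0](_ : _ = 0) ?enorm0 ?expr0n ?mulr0//.
  apply/colP => i; rewrite !mxE !big1 ?expr0n ?mul0r ?subrr ?mulr0//.
  - by move=> k _; rewrite mxE expr0n.
  - by move=> k _; rewrite mxE mulr0.
rewrite (hquadE u) enormZ ger0_norm ?invr_ge0// ler_pM2l ?invr_gt0//.
have b0' : 0 < enorm b by rewrite enorm_gt0.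
rewrite -ler_pdivrMr ?exprn_gt0//; apply: ub_le_sup.
  (* Coordinates of unit vectors are at most 1 in absolute value, so the triangle inequality bounds
     the set. *)
  exists (\sum_k \sum_l enorm (hess c w cs u k l)) => _ [x [y [x1 y1 ->]]].
  apply: le_trans (ler_enorm_sum _ _) _; apply: ler_sum => k _.
  apply: le_trans (ler_enorm_sum _ _) _; apply: ler_sum => l _.
  rewrite enormZ ler_piMl// normrM mulr_ile1//.
  - by rewrite -x1 enorm_coord.
  - by rewrite -y1 enorm_coord.
pose e := (enorm b)^-1 *: b; exists e, e; split; rewrite ?enorm_normalize//.
have -> : \sum_k \sum_l (e k 0 * e l 0) *: hess c w cs u k l =
    enorm b ^- 2 *: \sum_k \sum_l (b k 0 * b l 0) *: hess c w cs u k l.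
  rewrite scaler_sumr; apply: eq_bigr => k _; rewrite scaler_sumr.
  by apply: eq_bigr => l _; rewrite !mxE scalerA mulrACA -invfM.
by rewrite enormZ ger0_norm ?invr_ge0 ?exprn_ge0// mulrC.
Qed.

(** Closed form of the Jacobian of [gz], meaningful where the density is positive. *)
Definition gjac (z : 'cV[R]_(1 + d)) : 'M[R]_(q, 1 + d) :=
  row_mx ((2 * Num.sqrt (rho_of z))^-1 *: h (u_of z))
         (Num.sqrt (rho_of z) *: hjac (u_of z)).

Lemma rho_ofD (y z : 'cV[R]_(1 + d)) : rho_of (y + z) = rho_of y + rho_of z.
Proof. by rewrite /rho_of linearD mxE. Qed.

Lemma rho_ofZ t (z : 'cV[R]_(1 + d)) : rho_of (t *: z) = t * rho_of z.
Proof. by rewrite /rho_of linearZ mxE. Qed.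

Lemma gjac_mulE z v : gjac z *m v =
  (rho_of v / (2 * Num.sqrt (rho_of z))) *: h (u_of z)
  + Num.sqrt (rho_of z) *: (hjac (u_of z) *m u_of v).
Proof.
rewrite /gjac -{1}(vsubmxK v) mul_row_col -!scalemxAl; congr (_ + _).
rewrite [usubmx v]mx11_scalar mul_mx_scalar scalerA mulrC //.
Qed.

Lemma is_derive_gz z v i : 0 < rho_of z ->
  is_derive z v (fun z => gz c w cs z i 0) ((gjac z *m v) i 0).
Proof.
move=> z0.
rewrite -[z](addr0) -(scale0r v); apply/is_derive_line; rewrite scale0r addr0.
pose P t := h (u_of z) i 0 + t * (hjac (u_of z) *m u_of v) i 0
  + t ^+ 2 * hquad (u_of v) i 0.
(* The null term [t ^+ 2 * 0] gives the affine radicand the shape that [is_derive_quad] expects. *)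
pose S (t : R) := Num.sqrt (rho_of z + t * rho_of v + t ^+ 2 * 0).
rewrite (_ : (fun _ => _) = (S : R -> R) * P); last first.
  apply/funext => t; rewrite /gz /gfun mxE rho_ofD rho_ofZ.
  rewrite [RHS]/(S t * P t) /S mulr0 addr0 /P; congr (_ * _).
  by rewrite [u_of _]linearD linearZ/= -/(u_of z) -/(u_of v) hfun_line !mxE.
have dP : is_derive (0 : R) (1 : R) P ((hjac (u_of z) *m u_of v) i 0).
  exact: is_derive_quad.
have dS : is_derive (0 : R) (1 : R) S ((2 * Num.sqrt (rho_of z))^-1 * rho_of v).
  apply: is_derive1_comp; last exact: is_derive_quad.
  by rewrite mul0r expr0n mul0r !addr0; exact: is_derive1_sqrt.
have -> : (gjac z *m v) i 0 = rho_of v / (2 * Num.sqrt (rho_of z)) * h (u_of z) i 0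
    + Num.sqrt (rho_of z) * (hjac (u_of z) *m u_of v) i 0.
  by rewrite gjac_mulE !mxE.
apply: is_derive_eq; rewrite /S /P.
rewrite !mul0r expr0n !mul0r !addr0 addrC.
by rewrite /GRing.scale/=; field; rewrite gt_eqF// sqrtr_gt0.
Qed.

(** The factor [M] is kept general to serve for the identity ([gradg]), the projector ([DF]) and the
    pseudoinverse (the Newton map). *)
Lemma is_derive_mul_gz p (M : 'M[R]_(p, q)) z v i : 0 < rho_of z ->
  is_derive z v (fun z => (M *m gz c w cs z) i 0) ((M *m (gjac z *m v)) i 0).
Proof.
move=> z0.
rewrite (_ : (fun _ => _) = \sum_j (M i j \*: (fun z => gz c w cs z j 0))); last first.
  by apply/funext => y; rewrite mxE fct_sumE.
have := fun j => is_derive_gz v j z0 => H; apply: is_derive_eq; rewrite mxE//.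
Qed.

Lemma jac_mul_gz p (M : 'M[R]_(p, q)) z : 0 < rho_of z ->
  jac (fun z => M *m gz c w cs z) z = M *m gjac z.
Proof.
move=> z0; apply/matrixP => i j; rewrite mxE.
rewrite (@derive_val _ _ _ _ _ _ _
  (is_derive_col (fun i => is_derive_mul_gz M (ev R j) i z0))).
by rewrite /ev mulmxA -colE mxE.
Qed.

Lemma gradgE rh u : 0 < rh -> gradg c w cs rh u = gjac (pairv rh u).
Proof.
move=> rh0; rewrite -[RHS]mul1mx -jac_mul_gz; last first.
  by rewrite /rho_of /pairv col_mxKu mxE.
rewrite /gradg (_ : (fun z => 1%:M *m _) = gz c w cs)//.
by apply/funext => z; rewrite mul1mx.
Qed.

Lemma DFE u z : 0 < rho_of z -> DF c w cs u z = Dproj c w cs u *m gjac z.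
Proof. exact: jac_mul_gz. Qed.

End Lattice.

(** * Projectors, pseudoinverses and approximate fixed points *)

Section Projector.
Context {R : realType}.

Lemma enorm_proj n (P : 'M[R]_n) y : P^T = P -> P *m P = P ->
  enorm (P *m y) <= enorm y.
Proof.
move=> PT PP; have := cauchy_schwarz y (P *m y).
have -> : dotv y (P *m y) = enorm (P *m y) ^+ 2.
  by rewrite sqr_enorm dotv_mulmxl PT mulmxA PP.
have [->//|P0] := eqVneq (enorm (P *m y)) 0.
by rewrite expr2 ler_pM2r// lt0r P0 enorm_ge0.
Qed.

Lemma enorm_coproj n (P : 'M[R]_n) y : P^T = P -> P *m P = P ->
  enorm (P *m y - y) <= enorm y.
Proof.
move=> PT PP; rewrite enormBC -{1}(mul1mx y) -mulmxBl; apply: enorm_proj.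
  by rewrite linearB/= trmx1 PT.
by rewrite mulmxBl mulmxBr mulmx1 mul1mx mulmxBr mulmx1 PP subrr subr0.
Qed.

Lemma gram_unitmx m n (J : 'M[R]_(m, n)) : \rank J = n -> J^T *m J \in unitmx.
Proof.
move=> rJ; have fJ : row_free J^T by rewrite /row_free mxrank_tr rJ.
rewrite -row_free_unit; apply: inj_row_free => v vJ.
have : enorm (J *m v^T) = 0.
  have Jv : J^T *m J *m v^T = 0 by rewrite -(gram_sym J) -trmx_mul vJ trmx0.
  by apply/eqP; rewrite -sqrf_eq0 -dotv_gram Jv dotvE trmx0 mul0mx mxE.
move/eqP; rewrite enorm_eq0 -trmx_eq0 trmx_mul trmxK => /eqP vJ0.
by apply: (row_free_inj fJ); rewrite vJ0 mul0mx.
Qed.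

(** [J] and [G] share their column space, so [G X] and [D] fix each other's range; both being
    symmetric, transposition makes them equal. A left inverse of [G] cancels in [G X G = G]. *)
Lemma pinv_full_col_rank m n (J G : 'M[R]_(m, n)) (S : 'M[R]_n) X :
  \rank J = n -> S \in unitmx -> G = J *m S -> is_pinv G X ->
  X *m G = 1%:M /\ G *m X = J *m invmx (J^T *m J) *m J^T.
Proof.
move=> rJ Su GE [GXG _ GXs _]; have Ju := gram_unitmx rJ.
set D := J *m _ *m _.
have DJ : D *m J = J by rewrite /D -!mulmxA mulVmx// mulmx1.
have DT : D^T = D.
  by rewrite /D !trmx_mul trmxK trmx_inv gram_sym mulmxA.
have JE : J = G *m invmx S by rewrite GE mulmxK.
have GXJ : G *m X *m J = J by rewrite {1}JE mulmxA GXG -JE.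
have GXD : G *m X *m D = D by rewrite /D !mulmxA GXJ.
have DGX : D *m (G *m X) = G *m X by rewrite GE !mulmxA DJ.
split; last by rewrite -GXs -{1}DGX trmx_mul GXs DT GXD.
have [L LG] : exists L, L *m G = 1%:M.
  exists (invmx S *m invmx (J^T *m J) *m J^T).
  rewrite GE -!mulmxA (mulmxA J^T) (mulmxA (invmx (J^T *m J))) mulVmx//.
  by rewrite mul1mx mulVmx.
have : L *m (G *m X *m G) = L *m G by rewrite GXG.
by rewrite -!mulmxA mulmxA LG mul1mx.
Qed.

Lemma approx_fixpoint n (T : 'cV[R]_n -> 'cV[R]_n) x1 r : 0 < r ->
  (forall x y, enorm (x - x1) < r -> enorm (y - x1) < r ->
    enorm (T x - T y) <= enorm (x - y)) ->
  (forall x, enorm (x - x1) < r -> enorm (T x - x1) <= r) ->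
  forall e, 0 < e -> exists2 x, enorm (x - x1) < r & enorm (T x - x) <= e.
Proof.
move=> r0 Tne TB e e0.
(* iterating [x1 + k (T - x1)], a contraction of the ball into itself for [k < 1] *)
pose t := Num.min (1 / 2) (e / 2 / r); pose k := 1 - t.
have t0 : 0 < t by rewrite lt_min !divr_gt0.
have t1 : t <= 1 / 2 by rewrite ge_min lexx.
have tr : t * r <= e / 2 by rewrite -ler_pdivlMr// ge_min lexx orbT.
have k0 : 0 < k by rewrite /k; lra.
pose U x := x1 + k *: (T x - x1).
pose x n := iter n U x1.
have UB y : enorm (y - x1) < r -> enorm (U y - x1) < r.
  move=> yB; rewrite /U addrC addKr enormZ gtr0_norm//.
  apply: (@le_lt_trans _ _ (k * r)); first by rewrite ler_wpM2l ?(ltW k0)// TB.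
  by rewrite gtr_pMl// /k; lra.
have xB m : enorm (x m - x1) < r.
  by elim: m => [|m ih]; [rewrite subrr enorm0|exact: UB].
have xk m : enorm (U (x m) - x m) <= k ^+ m * r.
  elim: m => [|m ih]; first by rewrite expr0 mul1r ltW// UB// subrr enorm0.
  rewrite /= exprS -mulrA; apply: le_trans (ler_wpM2l (ltW k0) ih).
  rewrite {1 3}/U opprD addrACA subrr add0r -scalerBr enormZ gtr0_norm//.
  rewrite ler_wpM2l ?(ltW k0)// opprB addrA subrK.
  exact: Tne (UB _ (xB m)) (xB m).
have k1 : `|k| < 1 by rewrite gtr0_norm// /k; lra.
have e2r : 0 < e / 2 / r by rewrite !divr_gt0.
have /cvgrPdist_le /(_ _ e2r)[N _ /(_ N (leqnn N))] := cvg_expr k1.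
rewrite sub0r normrN ger0_norm ?exprn_ge0 ?(ltW k0)// ler_pdivlMr// => kN.
exists (x N) => //.
(* The first term is at most [k ^+ N * r <= e / 2] by the choice of [N], the second at most
   [t * r <= e / 2] by the choice of [t]. *)
have -> : T (x N) - x N = (U (x N) - x N) + t *: (T (x N) - x1).
  rewrite /U /k; move: (T (x N)) (x N) => a b.
  by apply/colP => i; rewrite !mxE; ring.
apply: le_trans (ler_enormD _ _) _; rewrite (splitr e).
apply: lerD; first exact: le_trans (xk N) kN.
rewrite enormZ gtr0_norm//; apply: le_trans tr; rewrite ler_wpM2l ?(ltW t0)//.
exact: TB.
Qed.

Lemma cvg_at_right0_le (f : R -> R) l k : f @ (0 : R) --> l ->
  (forall t, 0 < t <= 1 -> f t <= k) -> l <= k.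
Proof.
move=> /cvgrPdist_le fl fk; apply/ler_addgt0Pr => e e0.
have [de /= de0 hde] := fl e e0.
pose t := Num.min (de / 2) 1.
have t0 : 0 < t by rewrite lt_min divr_gt0//= ltr01.
have : `|l - f t| <= e.
  apply: hde; rewrite /= sub0r normrN gtr0_norm// gt_min; apply/orP; left; lra.
have : f t <= k by apply: fk; rewrite t0 ge_min lexx orbT.
by move=> h1 /ler_normlP[_ h2]; lra.
Qed.

End Projector.

(** * Continuity of the Jacobian along lines *)

Section Newton.
Context {R : realType} {q d : nat} (c : 'M[R]_(q, d)) (w : 'I_q -> R) (cs : R).
Context (cs0 : 0 < cs).
Notation h := (hfun c w cs).
Notation gz := (gz c w cs).
Notation gjac := (gjac c w cs).

Lemma cvg_quad (a b e : R) : (fun t : R => a + t * b + t ^+ 2 * e) @ (0 : R) --> a.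
Proof.
have /derivable1_diffP/differentiable_continuous : derivable
    (fun t : R => a + t * b + t ^+ 2 * e) (0 : R) (1 : R).
  exact: (@ex_derive _ _ _ _ _ _ _ (is_derive_quad a b e)).
rewrite /prop_for /continuous_at; set l := (X in _ --> X -> _).
by have -> : l = a by rewrite /l mul0r expr0n /= mul0r !addr0.
Qed.

Lemma cvg_hfun_line u b i :
  (fun t : R => h (u + t *: b) i 0) @ (0 : R) --> h u i 0.
Proof.
rewrite (_ : (fun _ => _) = (fun t : R => h u i 0 + t * (hjac c w cs u *m b) i 0
  + t ^+ 2 * hquad c w cs b i 0)); first exact: cvg_quad.
by apply/funext => t; rewrite hfun_line// !mxE.
Qed.

Lemma cvg_hjac_line (u b v : 'cV[R]_d) i :
  (fun t : R => (hjac c w cs (u + t *: b) *m v) i 0) @ (0 : R)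
    --> (hjac c w cs u *m v) i 0.
Proof.
pose cb := \sum_k c i k * b k 0; pose cv := \sum_k c i k * v k 0.
pose e := Num.sqrt (w i) * (cb * cv / (4 * cs ^+ 4) - dotv b v / (2 * cs ^+ 2)).
rewrite (_ : (fun _ => _) = (fun t : R => (hjac c w cs u *m v) i 0 + t * e
  + t ^+ 2 * 0)); first exact: cvg_quad.
apply/funext => t; rewrite !hjac_mulE dotvDl dotvZl -/cv.
have -> : \sum_k c i k * (u + t *: b) k 0 = (\sum_k c i k * u k 0) + t * cb.
  rewrite mulr_sumr -big_split/=; apply: eq_bigr => k _.
  by rewrite !mxE mulrDr mulrCA.
by rewrite /e; ring.
Qed.

Lemma cvg_gjac_line (y b v : 'cV[R]_(1 + d)) i : 0 < rho_of y ->
  (fun t : R => (gjac (y + t *: b) *m v) i 0) @ (0 : R) --> (gjac y *m v) i 0.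
Proof.
move=> y0.
have E z : (gjac z *m v) i 0 = rho_of v * (2 * Num.sqrt (rho_of z))^-1 * h (u_of z) i 0
    + Num.sqrt (rho_of z) * (hjac c w cs (u_of z) *m u_of v) i 0.
  by rewrite gjac_mulE !mxE.
rewrite E; under eq_fun do rewrite E.
have uE t : u_of (y + t *: b) = u_of y + t *: u_of b by rewrite /u_of linearD linearZ.
have cs_ : (fun t : R => Num.sqrt (rho_of (y + t *: b))) @ (0 : R)
    --> Num.sqrt (rho_of y).
  have rc : (fun t : R => rho_of (y + t *: b)) @ (0 : R) --> rho_of y.
    rewrite (_ : (fun _ => _) = (fun t : R => rho_of y + t * rho_of b + t ^+ 2 * 0)).
      exact: cvg_quad.
    by apply/funext => t; rewrite mulr0 addr0 rho_ofD rho_ofZ.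
  apply: continuous_cvg; [exact: sqrt_continuous|exact: rc].
apply: cvgD; apply: cvgM => //.
- apply: cvgM; first exact: cvg_cst.
  apply: cvgV; first by rewrite mulf_neq0// gt_eqF// sqrtr_gt0.
  by apply: cvgM => //; exact: cvg_cst.
- by under eq_fun do rewrite uE; exact: cvg_hfun_line.
- by under eq_fun do rewrite uE; exact: cvg_hjac_line.
Qed.

(** * The Newton map at the reference state and the bound on [Eperp] *)

Section Kantorovich.
Context (uh : 'cV[R]_d) (gt : 'cV[R]_q) (rh : R) (Ap : 'M[R]_(1 + d, q)).
Context (rkJ : \rank (Jbar c w cs uh) = (1 + d)%N) (rh0 : 0 < rh).
Context (pinvA : is_pinv (gradg c w cs rh uh) Ap).
Let x0 := pairv rh uh.
Let G := gradg c w cs rh uh.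
Let D := Dproj c w cs uh.
Let beta := (sigma_min G)^-1.
Let T (x : 'cV[R]_(1 + d)) := x - Ap *m (gz x - gt).

Lemma rho_of_pairv (r : R) (u : 'cV[R]_d) : rho_of (pairv r u) = r.
Proof. by rewrite /rho_of /pairv col_mxKu mxE. Qed.

Lemma u_of_pairv (r : R) (u : 'cV[R]_d) : u_of (pairv r u) = u.
Proof. by rewrite /u_of /pairv col_mxKd. Qed.

(** At the reference state the Jacobian of [g] is [Jbar] with rescaled columns, so both have the
    column space onto which [D] projects. *)
Lemma pinv_gradg : Ap *m G = 1%:M /\ G *m Ap = D.
Proof.
pose S : 'M[R]_(1 + d) :=
  block_mx ((2 * Num.sqrt rh)^-1)%:M 0 0 (Num.sqrt rh)%:M.
have Su : S \in unitmx.
  rewrite unitmxE det_ublock !det_scalar unitrM !unitrX// unitfE.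
    by rewrite gt_eqF// sqrtr_gt0.
  by rewrite invr_eq0 mulf_neq0// gt_eqF// sqrtr_gt0.
apply: (pinv_full_col_rank rkJ Su) => //.
rewrite /G gradgE// /Jbar jac_hfun// /gjac rho_of_pairv u_of_pairv.
by rewrite /S mul_row_block !mulmx0 addr0 add0r !mul_mx_scalar.
Qed.

(** This is why [T] can use [gz x - gt] in place of its projection. *)
Lemma mulAD (y : 'cV[R]_q) : Ap *m (D *m y) = Ap *m y.
Proof. by have [AG <-] := pinv_gradg; rewrite !mulmxA AG mul1mx. Qed.

Lemma mulDG (v : 'cV[R]_(1 + d)) : D *m (G *m v) = G *m v.
Proof. by have [AG <-] := pinv_gradg; rewrite -!mulmxA (mulmxA Ap) AG mul1mx. Qed.

Lemma Dsym : D^T = D.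
Proof. by case: pinv_gradg => _ <-; case: pinvA. Qed.

Lemma Didem : D *m D = D.
Proof. by have [AG <-] := pinv_gradg; rewrite mulmxA -(mulmxA G) AG mulmx1. Qed.

Lemma beta_gt0 : 0 < beta.
Proof. by have [AG _] := pinv_gradg; rewrite invr_gt0; case: (sigma_minP _ AG). Qed.

(** [sigma_min G] times the left norm is at most [|G Ap y| = |D y| <= |y|]. *)
Lemma enorm_pinv (y : 'cV[R]_q) : enorm (Ap *m y) <= beta * enorm y.
Proof.
have [AG GA] := pinv_gradg; have [s0 hs] := sigma_minP (isT : 0 < 1 + d)%N AG.
rewrite ler_pdivlMl//; apply: le_trans (hs _) _; rewrite mulmxA GA.
exact: enorm_proj Dsym Didem.
Qed.

Lemma is_derive_T (z v : 'cV[R]_(1 + d)) i : 0 < rho_of z ->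
  is_derive z v (fun z => T z i 0) ((v - Ap *m (gjac z *m v)) i 0).
Proof.
move=> z0; have dg := is_derive_mul_gz c w cs0 Ap v i z0.
have dz : is_derive z v (fun z : 'cV[R]_(1 + d) => z i 0) (v i 0).
  by apply: (is_derive_quad_line (e := 0)) => t; rewrite !mxE mulr0 addr0.
rewrite (_ : (fun _ => _) = (fun z : 'cV[R]_(1 + d) => z i 0) -
    (fun z => (Ap *m gz z) i 0) + cst ((Ap *m gt) i 0)); last first.
  apply/funext => y; transitivity (y i 0 - (Ap *m gz y) i 0 + (Ap *m gt) i 0) => //.
  rewrite /T mulmxBr; move: (Ap *m gz y) (Ap *m gt) => a b.
  by rewrite !mxE opprB addrA addrAC.
apply: is_derive_eq; rewrite addr0; move: (Ap *m _) => a.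
by rewrite !mxE.
Qed.

Context (mu : R).
Let r := enorm (x0 - T x0).
Let x1 := T x0.
Let B (z : 'cV[R]_(1 + d)) := enorm (z - x1) < r.
Context (Brho : forall z, B z -> 0 < rho_of z).
Context (Blip : forall za zb, B za -> B zb ->
  opnorm (DF c w cs uh za - DF c w cs uh zb) <= mu * enorm (za - zb)).
Context (small : 2 * beta * mu * r <= 1).

Lemma B_x1 : 0 < r -> B x1.
Proof. by rewrite /B subrr enorm0. Qed.

(** The point [x0] is at distance exactly [r] from [x1], so any positive step from it towards a
    point of the open ball enters the ball. *)
Lemma B_toward_x0 y t : 0 < t <= 1 -> B y -> B (x0 + t *: (y - x0)).
Proof.
move=> /andP[t0 t1] yB; rewrite /B.
have -> : x0 + t *: (y - x0) - x1 = (1 - t) *: (x0 - x1) + t *: (y - x1).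
  by apply/colP => i; rewrite !mxE; ring.
apply: le_lt_trans (ler_enormD _ _) _; rewrite !enormZ -/r.
rewrite ger0_norm ?subr_ge0// gtr0_norm//.
have : t * enorm (y - x1) < t * r by rewrite ltr_pM2l.
rewrite mulrBl mul1r; lra.
Qed.

Lemma B_convex y z t : 0 <= t <= 1 -> B y -> B z -> B (y + t *: (z - y)).
Proof.
move=> /andP[t0 t1] yB zB; rewrite /B.
have -> : y + t *: (z - y) - x1 = (1 - t) *: (y - x1) + t *: (z - x1).
  by apply/colP => i; rewrite !mxE; ring.
apply: le_lt_trans (ler_enormD _ _) _; rewrite !enormZ.
rewrite !ger0_norm ?subr_ge0//.
pose k := Num.max (enorm (y - x1)) (enorm (z - x1)).
apply: (@le_lt_trans _ _ ((1 - t) * k + t * k)).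
  by rewrite lerD// ler_wpM2l ?subr_ge0// /k le_max lexx ?orbT.
by rewrite -mulrDl subrK mul1r gt_max; apply/andP.
Qed.

Lemma B_dist y : B y -> enorm (y - x0) <= 2 * r.
Proof.
move=> yB; rewrite -(subrKA x1); apply: le_trans (ler_enormD _ _) _.
by rewrite [enorm (x1 - x0)]enormBC -/r mulrDl mul1r lerD2r ltW.
Qed.

Lemma le_DF_diff za zb v : B za -> B zb ->
  enorm ((DF c w cs uh za - DF c w cs uh zb) *m v)
  <= mu * enorm (za - zb) * enorm v.
Proof.
move=> aB bB; apply: le_trans (le_opnorm _ _) _.
by rewrite ler_wpM2r// Blip.
Qed.

(** The Lipschitz bound at two distinct points of [B], here [x1] and the midpoint of [x0] and [x1],
    forces the sign. *)
Lemma mu_ge0 : 0 < r -> 0 <= mu.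
Proof.
move=> r0; have xB := B_x1 r0.
have h01 : 0 < (1 / 2 : R) <= 1 by apply/andP; split; lra.
have := le_DF_diff (x0 - x1) xB (B_toward_x0 h01 xB).
set y := x0 + _; have -> : x1 - y = - (1 / 2) *: (x0 - x1).
  by apply/colP => i; rewrite !mxE; field.
rewrite enormZ normrN gtr0_norm -/r ?divr_gt0// => h0.
have {h0} := le_trans (enorm_ge0 _) h0.
by rewrite -!mulrA pmulr_lge0// !mulr_gt0// invr_gt0.
Qed.

(* [x0] lies on the boundary of [B], so this bound is a limit along the radius *)
Lemma le_DF_diff_x0 z v : 0 < r -> B z ->
  enorm (G *m v - D *m (gjac z *m v)) <= mu * enorm (x0 - z) * enorm v.
Proof.
move=> r0 zB; have mu0 := mu_ge0 r0; have xB := B_x1 r0.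
apply: le_enorm_dual; first by rewrite !mulr_ge0.
move=> l; set b := x1 - x0.
(* The subtracted term pays for replacing [|y - z|] by [|x0 - z| + t r]; it vanishes in the
   limit. *)
pose f t := dotv l (D *m (gjac (x0 + t *: b) *m v) - D *m (gjac z *m v))
  - t * (mu * enorm l * r * enorm v).
have E a : dotv l (D *m a - D *m (gjac z *m v)) =
    \sum_i (D^T *m l) i 0 * a i 0 - dotv l (D *m (gjac z *m v)).
  by rewrite dotvDr dotvNr [dotv l _]dotvC dotv_mulmxl dotvC.
have fl : f @ (0 : R) -->
    dotv l (D *m (gjac x0 *m v) - D *m (gjac z *m v))
    - 0 * (mu * enorm l * r * enorm v).
  apply: cvgB; last by apply: cvgM; [exact: cvg_id|exact: cvg_cst].
  rewrite E; under eq_fun do rewrite E.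
  apply: cvgB; last exact: cvg_cst.
  apply: cvg_big => [|i _]; first exact: add_continuous.
  apply: cvgM; first exact: cvg_cst.
  by apply: cvg_gjac_line; rewrite rho_of_pairv.
rewrite mul0r subr0 in fl; rewrite -(mulDG v) /G gradgE//.
apply: (cvg_at_right0_le fl) => t t01.
have yB := B_toward_x0 t01 xB; set y := x0 + t *: b in yB *.
have := le_DF_diff v yB zB; rewrite !DFE ?Brho// mulmxBl -!(mulmxA D) => le_yz.
rewrite /f -/y lerBlDr; apply: le_trans (cauchy_schwarz _ _) _.
apply: le_trans (ler_wpM2l (enorm_ge0 _) le_yz) _.
have yz : enorm (y - z) <= enorm (x0 - z) + t * r.
  rewrite /y addrAC; apply: le_trans (ler_enormD _ _) _.
  case/andP: t01 => t0 _; rewrite lerD2l enormZ gtr0_norm// /b.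
  by rewrite [enorm (x1 - _)]enormBC.
have : 0 <= mu * enorm l * enorm v by rewrite !mulr_ge0.
by move=> /ler_wpM2l /(_ _ _ yz); lra.
Qed.

(** As [Ap G = 1] and [Ap D = Ap], the derivative of [T] at [z] is [Ap] applied to the difference of
    the Jacobians of [F] at [x0] and [z]. *)
Lemma le_dT z v : 0 < r -> B z ->
  enorm (v - Ap *m (gjac z *m v)) <= beta * mu * enorm (x0 - z) * enorm v.
Proof.
move=> r0 zB; have [AG _] := pinv_gradg.
have -> : v - Ap *m (gjac z *m v) = Ap *m (G *m v - D *m (gjac z *m v)).
  by rewrite mulmxBr mulAD [Ap *m (G *m v)]mulmxA AG mul1mx.
apply: le_trans (enorm_pinv _) _; rewrite -!mulrA ler_pM2l ?beta_gt0// !mulrA.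
exact: le_DF_diff_x0.
Qed.

Lemma T_nonexpansive x y : B x -> B y -> enorm (T x - T y) <= enorm (x - y).
Proof.
move=> xB yB; have r0 : 0 < r := le_lt_trans (enorm_ge0 _) xB.
pose v := x - y.
have pB s : 0 <= s <= 1 -> B (y + s *: v) by move=> s01; exact: B_convex.
have := @enorm_mvt _ _ (fun s => T (y + s *: v))
  (fun s => v - Ap *m (gjac (y + s *: v) *m v)) (enorm v) 0.
have -> : y + 1 *: v = x by rewrite scale1r addrC subrK.
rewrite scale0r addr0 mul0r addr0; apply=> //.
- move=> s i s01; apply/(is_derive_line (fun z => T z i 0)).
  by apply: is_derive_T; exact: Brho (pB _ s01).
- move=> s /andP[s0 s1]; rewrite mul0r addr0.
  have sB : B (y + s *: v) by apply: pB; rewrite !ltW.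
  apply: le_trans (le_dT v r0 sB) _; rewrite ler_piMl//.
  (* Points of [B] are within [2 r] of [x0], so the factor is at most [2 beta mu r]. *)
  apply: le_trans small; rewrite [2 * beta]mulrC -!mulrA.
  rewrite ler_pM2l ?beta_gt0// mulrCA ler_wpM2l ?mu_ge0//.
  by rewrite enormBC B_dist.
Qed.

(** The derivative bound grows linearly from [x0], so integration gains a factor 1/2:
    [k / 2 <= beta mu (2 r)^2 / 2 <= r]. *)
Lemma T_ball x : B x -> enorm (T x - x1) <= r.
Proof.
move=> xB; have r0 : 0 < r := le_lt_trans (enorm_ge0 _) xB.
have mu0 := mu_ge0 r0; have b0 := ltW beta_gt0.
pose v := x - x0; pose k := beta * mu * enorm v ^+ 2.
have k0 : 0 <= k by rewrite !mulr_ge0 ?exprn_ge0.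
apply: (@le_trans _ _ (0 + k / 2)); last first.
  have := B_dist xB; rewrite -/v => vr.
  have : enorm v ^+ 2 <= (2 * r) ^+ 2 by rewrite lerXn2r ?nnegrE// mulr_ge0// ltW.
  move=> /(ler_wpM2l (mulr_ge0 b0 mu0)); rewrite -/k => kr.
  by have := ler_wpM2r (ltW r0) small; lra.
have := @enorm_mvt _ _ (fun s => T (x0 + s *: v))
  (fun s => v - Ap *m (gjac (x0 + s *: v) *m v)) 0 k.
have -> : x0 + 1 *: v = x by rewrite scale1r addrC subrK.
rewrite scale0r addr0; apply.
- by rewrite add0r divr_ge0.
- move=> s i /andP[s0 s1]; apply/(is_derive_line (fun z => T z i 0)).
  (* At [s = 0] the point is [x0], outside the open ball; its density is positive by [rh0]. *)
  apply: is_derive_T; have [->|sn0] := eqVneq s 0.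
    by rewrite scale0r addr0 rho_of_pairv.
  by apply: Brho; apply: B_toward_x0 => //; rewrite lt0r sn0 s0.
- move=> s /andP[s0 s1].
  have sB : B (x0 + s *: v) by apply: B_toward_x0 => //; rewrite s0 ltW.
  apply: le_trans (le_dT v r0 sB) _.
  rewrite opprD addrA subrr add0r enormN enormZ gtr0_norm// add0r /k; lra.
Qed.

Lemma newton_approx e : 0 < e -> exists x, [/\ 0 < rho_of x,
  enorm (x - x0) <= 2 * r & enorm (Ap *m (gz x - gt)) <= e].
Proof.
move=> e0; have := enorm_ge0 (x0 - T x0); rewrite -/r le0r => /orP[/eqP r0|r0].
  (* If [r = 0] the ball is empty, but [x0] is already a fixed point of [T]. *)
  exists x0; rewrite rho_of_pairv subrr enorm0 r0 mulr0; split=> //.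
  by move: r0; rewrite /r /T subKr => ->; exact: ltW.
have [x xB xT] := approx_fixpoint r0 T_nonexpansive T_ball e0.
exists x; split; [exact: Brho|exact: B_dist|].
by move: xT; rewrite /T addrAC subrr add0r enormN.
Qed.

Lemma enorm_u_of (z : 'cV[R]_(1 + d)) : enorm (u_of z) <= enorm z.
Proof.
rewrite -ler_sqr ?nnegrE// !sqr_enorm -[in leRHS](vsubmxK z) [leRHS]dotvE.
by rewrite tr_col_mx mul_row_col mxE -!dotvE lerDr dotv_ge0.
Qed.

(** [D] fixes the columns of [Jbar], which carry the constant and linear terms of [h] at [uh]. *)
Lemma Dproj_sub_gz x : D *m gz x - gz x = Num.sqrt (rho_of x) *:
  (D *m hquad c w cs (u_of x - uh) - hquad c w cs (u_of x - uh)).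
Proof.
have DJ : D *m Jbar c w cs uh = Jbar c w cs uh.
  by rewrite /D /Dproj -!mulmxA mulVmx ?mulmx1// gram_unitmx.
have [Dh DH] : D *m h uh = h uh /\ D *m hjac c w cs uh = hjac c w cs uh.
  by apply: eq_row_mx; rewrite -mul_mx_row -jac_hfun.
set b := u_of x - uh.
have -> : gz x = Num.sqrt (rho_of x) *: (h uh + hjac c w cs uh *m b + hquad c w cs b).
  rewrite /Defs.gz /gfun; have := hfun_line c w cs0 uh b 1.
  by rewrite expr1n !scale1r /b addrC subrK => ->.
clearbody b; rewrite -scalemxAr -scalerBr !mulmxDr Dh mulmxA DH; congr (_ *: _).
by rewrite opprD addrACA subrr add0r.
Qed.

Let Dl := Delta c w cs uh gt rh.

Lemma Eperp_le : (0 < d)%N ->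
  Eperp c w cs uh gt <=
  2 * beta ^+ 2 * Dl ^+ 2 * Hnorm c w cs uh * Num.sqrt (rh + 2 * beta * Dl).
Proof.
move=> d0; have b0 := beta_gt0.
have r_le : r <= beta * Dl.
  rewrite /r /T subKr; apply: le_trans (enorm_pinv _) _.
  by rewrite /Dl /Delta /Defs.gz /x0 rho_of_pairv u_of_pairv.
have r0 : 0 <= r := enorm_ge0 _.
have Hn0 : 0 <= Hnorm c w cs uh.
  (* Nonnegativity of [Hnorm] is read off from [hquad_le] at a nonzero vector, which exists as
     [0 < d]. *)
  pose e : 'cV[R]_d := const_mx 1.
  have e0 : 0 < enorm e.
    rewrite enorm_gt0; apply/eqP => /colP /(_ (Ordinal d0)).
    by rewrite !mxE => /eqP; rewrite oner_eq0.
  have := le_trans (enorm_ge0 _) (hquad_le c w cs0 uh e).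
  by rewrite pmulr_rge0 ?invr_gt0// pmulr_lge0// exprn_gt0.
have [K K0 hK] := mulmx_bounded G.
apply/ler_addgt0Pr => e e0.
(* The tolerance [e / K] makes the residual, the image under [G] of the Newton correction, at most
   [e]. *)
have [x [rx xr xe]] := newton_approx (divr_gt0 e0 K0).
have {xr} xr : enorm (x - x0) <= 2 * (beta * Dl) by lra.
apply: (@le_trans _ _ (enorm (D *m gt - gz x))).
  apply: ge_inf; first by exists 0 => _ [? [? [_ ->]]].
  by exists (rho_of x), (u_of x); split => //; exact: ltW.
(* Split into the residual of the projected equation, which lies in the range of [D], and the normal
   defect of [gz x]. *)
have -> : D *m gt - gz x = - (G *m (Ap *m (gz x - gt))) + (D *m gz x - gz x).
  have [_ GA] := pinv_gradg; rewrite mulmxA GA mulmxBr opprB.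
  by rewrite addrA subrK.
apply: le_trans (ler_enormD _ _) _; rewrite addrC enormN; apply: lerD; last first.
  by apply: le_trans (hK _) _; rewrite -ler_pdivlMl// mulrC.
rewrite Dproj_sub_gz enormZ ger0_norm ?sqrtr_ge0// mulrC.
have Du : u_of x - uh = u_of (x - x0).
  by rewrite /u_of linearB/= -/(u_of x0) u_of_pairv.
have rho_le : rho_of x <= rh + 2 * beta * Dl.
  have := le_trans (enorm_coord (x - x0) (lshift d ord0)) xr.
  move=> /ler_normlP[_]; rewrite [X in X <= _](_ : _ = rho_of x - rh); first lra.
  rewrite /x0 /pairv -[x](vsubmxK x) opp_col_mx add_col_mx col_mxEu.
  by rewrite /rho_of col_mxKu !mxE.
apply: ler_pM; rewrite ?sqrtr_ge0//; last by rewrite ler_wsqrtr.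
apply: le_trans (enorm_coproj _ Dsym Didem) _.
apply: le_trans (hquad_le c w cs0 uh _) _.
have u_le : enorm (u_of x - uh) <= 2 * (beta * Dl).
  by rewrite Du; apply: le_trans (enorm_u_of _) xr.
(* The constant arises as [2^-1 * (2 * beta * Dl) ^+ 2 = 2 * beta ^+ 2 * Dl ^+ 2]. *)
have : enorm (u_of x - uh) ^+ 2 <= (2 * (beta * Dl)) ^+ 2.
  by rewrite lerXn2r// nnegrE//; lra.
by move=> /(ler_wpM2l Hn0); lra.
Qed.

End Kantorovich.
End Newton.

(** * Distance from a vector to a ray and the optimal density *)

Section ReferenceDensity.
Context {R : realType} {q : nat} (h g : 'cV[R]_q).
Context (hg : 0 < dotv h g).
Let s := dotv h g / enorm h ^+ 2.

Lemma ray_enorm_gt0 : 0 < enorm h.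
Proof.
rewrite enorm_gt0; apply/negP => /eqP h0; move: hg.
by rewrite h0 dotv0l ltxx.
Qed.

Lemma ray_coef_gt0 : 0 < s.
Proof. by rewrite divr_gt0// exprn_gt0// ray_enorm_gt0. Qed.

(** Completing the square in [t]: the constant part is the squared distance from [g] to the line
    spanned by [h]. *)
Lemma sqr_dist_ray t : enorm (t *: h - g) ^+ 2 =
  enorm g ^+ 2 - dotv h g ^+ 2 / enorm h ^+ 2 + enorm h ^+ 2 * (t - s) ^+ 2.
Proof.
rewrite sqr_enorm dotvDl !dotvDr !dotvNl !dotvNr !dotvZl !dotvZr (dotvC g h).
by rewrite -!sqr_enorm /s; field; rewrite gt_eqF// ray_enorm_gt0.
Qed.

Lemma dist_ray_min t : enorm (s *: h - g) <= enorm (t *: h - g).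
Proof.
rewrite -ler_sqr ?nnegrE// !sqr_dist_ray subrr expr0n/= mulr0 addr0 lerDl.
by rewrite mulr_ge0// sqr_ge0.
Qed.

Lemma dist_ray_sin theta : cos theta = dotv h g / (enorm h * enorm g) ->
  enorm (s *: h - g) = enorm g * `|sin theta|.
Proof.
move=> cosE; have h0 := ray_enorm_gt0.
have g0 : 0 < enorm g.
  rewrite enorm_gt0; apply/negP => /eqP g0; move: hg.
  by rewrite g0 dotvC dotv0l ltxx.
apply/eqP; rewrite -(eqrXn2 (n := 2))//; last by rewrite mulr_ge0.
rewrite sqr_dist_ray subrr expr0n/= mulr0 addr0.
rewrite exprMn real_normK ?num_real// sin2cos2 cosE; apply/eqP.
by field; rewrite !gt_eqF.
Qed.

End ReferenceDensity.
Unset Implicit Arguments. Set Strict Implicit. Set Printing Implicit Defensive.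

Theorem theorem2 (R : realType) (d q : nat) (c : 'M[R]_(q, d)) (w : 'I_q -> R)
  (cs : R) :
  (0 < d)%N -> (0 < q)%N -> (forall i, 0 < w i) -> 0 < cs ->
  isotropic c w cs ->
  forall (uh : 'cV[R]_d),
  \rank (Jbar c w cs uh) = (1 + d)%N ->
  forall (gt : 'cV[R]_q),
  (* Part 1: Newton-Kantorovich based bound *)
  (forall (rh : R), 0 < rh ->
   let beta := (sigma_min (gradg c w cs rh uh))^-1 in
   let Dl := Delta c w cs uh gt rh in
   forall (Ap : 'M[R]_(1 + d, q)), is_pinv (gradg c w cs rh uh) Ap ->
   let z0 := Ap *m (Ffun c w cs uh (pairv rh uh) - Dproj c w cs uh *m gt) in
   let r := enorm z0 in
   let z1 := pairv rh uh - z0 in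
   let B := [set z : 'cV[R]_(1 + d) | enorm (z - z1) < r] in
   forall mu : R,
   (forall z, B z -> 0 < rho_of z) ->
   (forall za zb, B za -> B zb ->
      opnorm (DF c w cs uh za - DF c w cs uh zb) <= mu * enorm (za - zb)) ->
   2 * beta * mu * r <= 1 ->
   Eperp c w cs uh gt
     <= 2 * beta ^+ 2 * Dl ^+ 2 * Hnorm c w cs uh * Num.sqrt (rh + 2 * beta * Dl))
  /\
  (* Part 2: optimal choice of the reference density *)
  (0 < dotv (hfun c w cs uh) gt ->
   let s := dotv (hfun c w cs uh) gt / enorm (hfun c w cs uh) ^+ 2 in
   (forall rho : R, 0 < rho -> Delta c w cs uh gt (s ^+ 2) <= Delta c w cs uh gt rho)
   /\
   (forall theta : R,
      cos theta = dotv (hfun c w cs uh) gt / (enorm (hfun c w cs uh) * enorm gt) ->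
      Delta c w cs uh gt (s ^+ 2) = enorm gt * `|sin theta|)).
Proof.
move=> d0 _ _ cs0 _ uh rkJ gt; split=> [rh rh0 /= Ap pinvA mu|hg].
  (* This identifies [z0] with [x0 - T x0], the projector being absorbed by [Ap]. *)
  have -> : Ap *m (Ffun c w cs uh (pairv rh uh) - Dproj c w cs uh *m gt) =
      pairv rh uh - (pairv rh uh - Ap *m (gz c w cs (pairv rh uh) - gt)).
    by rewrite subKr /Ffun -mulmxBr (mulAD _ _ _ pinvA).
  rewrite subKr => Brho Blip small.
  exact: (Eperp_le cs0 rkJ rh0 pinvA Brho Blip small d0).
have s0 := ray_coef_gt0 hg.
(* Since [s > 0], the root of [s ^+ 2] is [s]; the minimum over all real multiples of [h] then
   covers every [Num.sqrt rho]. *)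
split=> [rho _|theta]; rewrite /Delta sqrtr_sqr gtr0_norm//.
  exact: dist_ray_min.
exact: dist_ray_sin.
Qed.
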